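(* Let $n,m\ge1$. For every (not necessarily generic) distribution $D$ over profiles of $n$ (not necessarily XOS) valuations on the item set $[m]$ there exist $(1/2)$-median prices: there are a price vector $\mathbf{p}\in\mathbb{R}_{\ge0}^m$ and a choice rule profile $\mathbf{A}$ such that, when $\mathbf{v}\sim D$ and agents sequentially acquire bundles at prices $\mathbf{p}$ according to $\mathbf{A}$, every item $j\in[m]$ is allocated with probability exactly $1/2$.
   Context: Valuations are functions $v:2^{[m]}\to\mathbb{R}_{\ge0}$ with $v(\emptyset)=0$ that are monotone ($v(S)\le v(T)$ for $S\subseteq T$). $D$ need not be a product distribution. Demand: for $\mathbf{p}\in\mathbb{R}_{\ge0}^m$ and $M\subseteq[m]$, the demand correspondence $\mathcal{D}(v,\mathbf{p},M)$ is the set of all $B\subseteq M$ maximizing $v(B)-\sum_{j\in B}p_j$ over subsets of $M$. Choice rule: a choice rule $A_i$ for agent $i$ maps each nonempty collection $\mathcal{D}\subseteq2^{[m]}$ to a probability distribution over elements of $\mathcal{D}$. Given a choice rule profile $\mathbf{A}=(A_1,\dots,A_n)$, agents $1,\dots,n$ arrive in this order, and each agent $i$ receives a set drawn (with fresh independent randomness) from $A_i(\mathcal{D}(v_i,\mathbf{p},M_i))$, where $M_i$ is the set of items not yet allocated. $\alpha$-median prices (general distributions): $\mathbf{p}$ such that there is a choice rule profile $\mathbf{A}$ (a witness) under which the probability that item $j$ is allocated lies in $[\alpha,1-\alpha]$ for every $j\in[m]$. *)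

(* Defs.v *)
From HB Require Import structures.
From mathcomp Require Import all_boot all_order all_algebra.
From mathcomp Require Import all_classical all_reals all_analysis.

Set Implicit Arguments.
Unset Strict Implicit.
Unset Printing Implicit Defensive.
Import Order.TTheory GRing.Theory Num.Theory.
Local Open Scope ring_scope.

(* Items are the elements of 'I_m and bundles are finite sets {set 'I_m}. *)

Record valuation (R : realType) (m : nat) := Valuation {
  val_fun :> {set 'I_m} -> R ;
  valuation_ge0 : forall S : {set 'I_m}, 0 <= val_fun S ;
  valuation0 : val_fun finset.set0 = 0 ;
  valuation_mono : forall S T : {set 'I_m}, S \subset T -> val_fun S <= val_fun T
}.

Definition zero_valuation (R : realType) (m : nat) : valuation R m :=
  @Valuation R m (fun=> 0) (fun=> lexx 0) (erefl 0) (fun _ _ _ => lexx 0).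

HB.instance Definition _ (R : realType) (m : nat) :=
  gen_eqMixin (valuation R m).
HB.instance Definition _ (R : realType) (m : nat) :=
  gen_choiceMixin (valuation R m).
HB.instance Definition _ (R : realType) (m : nat) :=
  isPointed.Build (valuation R m) (zero_valuation R m).

(* The sigma-algebra on valuation profiles is the trace of the Borel
   sigma-algebra of R^(n * 2^m): it is generated by the maps v |-> v i S. *)
Definition profile (R : realType) (n m : nat) :=
  g_sigma_algebraType
    (\bigcup_(x : 'I_n * {set 'I_m})
       preimage_set_system [set: 'I_n -> valuation R m]
         (fun v => v x.1 x.2 : R) measurable)%classic.

Definition utility (R : realType) (m : nat) (v : valuation R m)
    (p : 'rV[R]_m) (B : {set 'I_m}) : R :=
  v B - \sum_(j in B) p ord0 j.

Definition demand (R : realType) (m : nat) (v : valuation R m)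
    (p : 'rV[R]_m) (M : {set 'I_m}) : {set {set 'I_m}} :=
  [set B : {set 'I_m} | (B \subset M) &&
    [forall B' : {set 'I_m}, (B' \subset M) ==>
       (utility v p B' <= utility v p B)]]%SET.

(* A E is the probability mass function of a distribution on the members of E;
   only nonempty E are constrained, and demand sets are never empty. *)
Record choice_rule (R : realType) (m : nat) := ChoiceRule {
  choice_fun :> {set {set 'I_m}} -> {set 'I_m} -> R ;
  choice_ge0 : forall (E : {set {set 'I_m}}) (B : {set 'I_m}),
    E != finset.set0 -> 0 <= choice_fun E B ;
  choice_out : forall (E : {set {set 'I_m}}) (B : {set 'I_m}),
    E != finset.set0 -> B \notin E -> choice_fun E B = 0 ;
  choice_sum1 : forall E : {set {set 'I_m}},
    E != finset.set0 -> \sum_(B in E) choice_fun E B = 1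
}.

Definition available (n m : nat) (B : {ffun 'I_n -> {set 'I_m}}) (i : 'I_n) :
    {set 'I_m} :=
  (~: \bigcup_(k : 'I_n | (k < i)%N) B k)%SET.

(* Given the profile v, the probability that every agent i receives B i: by the
   chain rule, the product over i of the conditional probability that agent i
   picks B i given the picks of the agents before i. *)
Definition outcome_prob (R : realType) (n m : nat) (v : 'I_n -> valuation R m)
    (p : 'rV[R]_m) (A : 'I_n -> choice_rule R m)
    (B : {ffun 'I_n -> {set 'I_m}}) : R :=
  \prod_(i < n) A i (demand (v i) p (available B i)) (B i).

Definition item_prob_given (R : realType) (n m : nat)
    (v : 'I_n -> valuation R m) (p : 'rV[R]_m) (A : 'I_n -> choice_rule R m)
    (j : 'I_m) : R :=
  \sum_(B : {ffun 'I_n -> {set 'I_m}} | j \in (\bigcup_(i < n) B i)%SET)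
    outcome_prob v p A B.

(* The integrand takes values in [0, 1] and is measurable, since it depends on v
   only through finitely many comparisons of utilities. *)
Definition item_prob (R : realType) (n m : nat)
    (D : probability (profile R n m) R) (p : 'rV[R]_m)
    (A : 'I_n -> choice_rule R m) (j : 'I_m) : \bar R :=
  \int[D]_(v in setT) (item_prob_given v p A j)%:E.

Definition median_witness (R : realType) (n m : nat) (alpha : R)
    (D : probability (profile R n m) R) (p : 'rV[R]_m)
    (A : 'I_n -> choice_rule R m) : Prop :=
  forall j : 'I_m,
    (alpha%:E <= item_prob D p A j <= (1 - alpha)%:E)%E.

(* Main.v *)
Require Import Defs.
From mathcomp Require Import all_boot all_order all_algebra.
From mathcomp Require Import all_classical all_reals all_analysis.
From mathcomp Require Import fingroup perm measurable_realfun zify ring lra.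

Set Implicit Arguments.
Unset Strict Implicit.
Unset Printing Implicit Defensive.
Import Order.TTheory GRing.Theory Num.Theory.
Import numFieldNormedType.Exports.
Local Open Scope ring_scope.

(** Let every agent choose a subset of the available items by softmax with
    inverse temperature [b]. The probability that item [j] is sold then varies
    continuously with the prices; it is at least 1/2 when [p_j = 0], because
    valuations are monotone, and at most 1/2 when [p_j] is large, because
    valuations are rarely large. By the Poincare-Miranda theorem some price
    vector sells all items with probability close to 1/2. Let [b] tend to
    infinity and the prices [q] converge to [p] along a subsequence. On a demand
    set at [p], all utilities at [p] agree, so the softmax there only depends on
    [p - q] and not on the valuation: any limit of these distributions is a
    choice rule, and dominated convergence yields the exact probabilities.

    Poincare-Miranda is used in discrete form, for labels [l_i] on the grid
    [{0..n}^m] with [l_i = 0] on [x_i = 0] and [l_i = n] on [x_i = n]. The sum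
    over all simplices [x_0, ..., x_m] of Kuhn's triangulation of the
    orientation sign times the product of the [l_i(x_(i+1)) - l_i(x_i)] is a
    discrete [int dl_1 /\ ... /\ dl_m]; by a discrete Stokes theorem it only
    depends on the boundary values, hence equals its value [n^m] at
    [l_i(x) = x_i]. *)

(** * The discrete Poincare-Miranda theorem *)

(* [t j] is the time at which the monotone path from [q] steps in direction [j]. *)
Definition kuhn_vertex (m : nat) (t : 'S_m) (q : 'I_m -> nat) (k : nat)
    (j : 'I_m) : nat :=
  (q j + (t j < k))%N.

Definition kuhn_edge (m : nat) (l : ('I_m -> nat) -> int) (t : 'S_m)
    (q : 'I_m -> nat) (k : nat) : int :=
  l (kuhn_vertex t q k.+1) - l (kuhn_vertex t q k).

(* The labels other than [l i] are assigned in order to the steps other than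
   step [s]. *)
Definition kuhn_skip (m : nat) (i : 'I_m.+1)
    (l : 'I_m.+1 -> ('I_m.+1 -> nat) -> int) (t : 'S_m.+1)
    (q : 'I_m.+1 -> nat) (s : nat) : int :=
  \prod_(k < m) kuhn_edge (l (lift i k)) t q (bump s k).

(** Right multiplication by the transposition flips every sign and keeps every [F t], so the sum
    equals its own negative. *)
Lemma sum_perm_odd_invariant (m : nat) (F : 'S_m -> int) (a b : 'I_m) :
  a != b -> (forall t : 'S_m, F (t * tperm a b)%g = F t) ->
  \sum_(t : 'S_m) (-1) ^+ odd_perm t * F t = 0.
Proof.
move=> neq_ab Finv; set S := \sum_t _.
suff: S = - S by lia.
rewrite {1}/S (reindex_inj (mulIg (tperm a b))) -sumrN.
apply: eq_bigr => t _.
by rewrite Finv odd_permM odd_tperm neq_ab addbT signrN mulNr.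
Qed.

(** Swapping two consecutive steps of a path moves only the vertex visited between them. *)
Lemma kuhn_vertex_tperm (m : nat) (t : 'S_m) (q : 'I_m -> nat) (a b : 'I_m)
    (c : nat) :
  b = a.+1 :> nat -> c != b ->
  kuhn_vertex (t * tperm a b)%g q c = kuhn_vertex t q c.
Proof.
move=> ba /eqP cb; apply/funext => j; rewrite /kuhn_vertex permM.
congr (_ + nat_of_bool _)%N; rewrite ba in cb.
by case: tpermP => [->|->|//]; rewrite ?ba; apply/idP/idP; lia.
Qed.

(* The sum of the two skipped products does not involve vertex [s.+1], so it is
   invariant under exchanging the steps [s] and [s.+1], which reverses signs. *)
Lemma kuhn_skip_succ (m : nat) (i : 'I_m.+1)
    (l : 'I_m.+1 -> ('I_m.+1 -> nat) -> int) (g : ('I_m.+1 -> nat) -> int)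
    (q : 'I_m.+1 -> nat) (c s : nat) :
  (s < m)%N -> c != s.+1 ->
  \sum_(t : 'S_m.+1) (-1) ^+ odd_perm t *
      (g (kuhn_vertex t q c) * kuhn_skip i l t q s.+1) =
  - \sum_(t : 'S_m.+1) (-1) ^+ odd_perm t *
      (g (kuhn_vertex t q c) * kuhn_skip i l t q s).
Proof.
move=> sm cs; apply/eqP; rewrite -addr_eq0 -big_split /=.
under eq_bigr do rewrite -mulrDr -mulrDr.
have s1m : (s.+1 < m.+1)%N by [].
pose a : 'I_m.+1 := Ordinal (ltnW s1m); pose b : 'I_m.+1 := Ordinal s1m.
pose k0 : 'I_m := Ordinal sm.
apply/eqP; apply: (@sum_perm_odd_invariant _ _ a b).
  by apply/eqP => /(congr1 val) /=; lia.
(* The two products differ only in factor [k0], which sits on step [s] in one and on step [s.+1] in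
   the other; the two increments telescope across vertex [s.+1]. *)
have skipE t : kuhn_skip i l t q s.+1 + kuhn_skip i l t q s =
    (l (lift i k0) (kuhn_vertex t q s.+2) - l (lift i k0) (kuhn_vertex t q s)) *
    \prod_(k < m | k != k0) kuhn_edge (l (lift i k)) t q (bump s k).
  rewrite /kuhn_skip (bigD1 k0)//= [X in _ + X](bigD1 k0)//=.
  have -> : \prod_(k < m | k != k0) kuhn_edge (l (lift i k)) t q (bump s.+1 k)
          = \prod_(k < m | k != k0) kuhn_edge (l (lift i k)) t q (bump s k).
    apply: eq_bigr => k /eqP/eqP; rewrite -val_eqE /= => ks.
    by congr kuhn_edge; rewrite /bump; lia.
  rewrite -mulrDl; congr (_ * _); rewrite /kuhn_edge /bump.
  by rewrite ltnn leqnn add0n add1n addrC addrA subrK.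
move=> t; rewrite !skipE !(@kuhn_vertex_tperm _ t q a b)//=; try lia.
congr (_ * (_ * _)); apply: eq_bigr => k; rewrite -val_eqE /= => ks.
by rewrite /kuhn_edge !(@kuhn_vertex_tperm _ t q a b)//= /bump; lia.
Qed.

(** Each move of the omitted step by one costs a sign. The hypothesis on [c] keeps vertex [c] away
    from the vertices [s.+1, ..., s + d] that are crossed. *)
Lemma kuhn_skip_up (m : nat) (i : 'I_m.+1)
    (l : 'I_m.+1 -> ('I_m.+1 -> nat) -> int) (g : ('I_m.+1 -> nat) -> int)
    (q : 'I_m.+1 -> nat) (c s d : nat) :
  (s + d <= m)%N -> (c <= s)%N || (s + d < c)%N ->
  \sum_(t : 'S_m.+1) (-1) ^+ odd_perm t *
      (g (kuhn_vertex t q c) * kuhn_skip i l t q (s + d)) =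
  (-1) ^+ d * \sum_(t : 'S_m.+1) (-1) ^+ odd_perm t *
      (g (kuhn_vertex t q c) * kuhn_skip i l t q s).
Proof.
elim: d => [|d IH] dm cs; first by rewrite addn0 mul1r.
by rewrite addnS kuhn_skip_succ ?IH; [rewrite exprS mulN1r mulNr | lia..].
Qed.

(* Performing the last step of the path first, instead of not at all, translates
   the rest of the path by one unit. *)
Lemma kuhn_cycle (m : nat) (i : 'I_m.+1)
    (l : 'I_m.+1 -> ('I_m.+1 -> nat) -> int) (g : ('I_m.+1 -> nat) -> int)
    (q : 'I_m.+1 -> nat) :
  \sum_(t : 'S_m.+1) (-1) ^+ odd_perm t *
      (g (kuhn_vertex t q i.+1) * kuhn_skip i l t q 0) =
  (-1) ^+ m * \sum_(t : 'S_m.+1) (-1) ^+ odd_perm t *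
      let q' j := (q j + (t j == ord_max))%N in
      (g (kuhn_vertex t q' i) * kuhn_skip i l t q' m).
Proof.
(* The cycle sending [ord_max] to [0] and every other [k] to [k.+1], of sign [(-1) ^+ m]. *)
pose cyc : 'S_m.+1 := lift_perm ord_max ord0 1%g.
rewrite (reindex_inj (mulIg cyc)) big_distrr; apply: eq_bigr => t _ /=.
have odd_cyc : odd_perm cyc = odd m.
  by rewrite /cyc odd_lift_perm odd_perm1 addbF /= addbF.
rewrite odd_permM odd_cyc signr_addb signr_odd mulrA; congr (_ * _).
  by rewrite mulrC.
have vertE k : (k <= m)%N -> kuhn_vertex (t * cyc)%g q k.+1 =
    kuhn_vertex t (fun j => q j + (t j == ord_max))%N k.
  move=> km; apply/funext => j; rewrite /kuhn_vertex permM -addnA.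
  congr (_ + _)%N; rewrite /cyc; case: (unliftP ord_max (t j)) => [u|] ->.
    by rewrite lift_perm_lift perm1 eq_sym (negbTE (neq_lift _ _)) lift0 lift_max.
  by rewrite lift_perm_id eqxx /= ltnNge km.
rewrite (vertE i (ltn_ord i)); congr (_ * _); apply: eq_bigr => k _.
by rewrite /kuhn_edge /bump leq0n add1n leqNgt ltn_ord add0n !vertE // ltnW.
Qed.

(** The shift trades the face [q j = 0] for the face [q j = n], and [F] vanishes on both. Reindexing
    uses the cyclic shift [ordS]; the terms that wrap around are zero on either side. *)
Lemma big_shift_coord (m n : nat) (j : 'I_m) (F : ('I_m -> nat) -> int) :
  (forall q : 'I_m -> nat, q j = 0%N \/ q j = n -> F q = 0) ->
  \sum_(q : {ffun 'I_m -> 'I_n}) F (fun k => q k + (k == j))%N =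
  \sum_(q : {ffun 'I_m -> 'I_n}) F (fun k => q k).
Proof.
move=> F0; pose sh (q : {ffun 'I_m -> 'I_n}) : {ffun 'I_m -> 'I_n} :=
  [ffun k => if k == j then ordS (q k) else q k].
have sh_inj : injective sh.
  move=> q q' /ffunP E; apply/ffunP => k; have := E k; rewrite !ffunE.
  by case: eqP => // _; exact: ordS_inj.
rewrite [RHS](reindex_inj sh_inj); apply: eq_bigr => q _.
have [qj|qj] := ltnP (q j).+1 n.
  congr F; apply/funext => k; rewrite ffunE.
  case: eqP => [->|_]; last by rewrite addn0.
  by rewrite /= modn_small // addn1.
have {}qj : (q j).+1 = n by apply/eqP; rewrite eqn_leq qj ltn_ord.
rewrite !F0 //; last by right; rewrite eqxx addn1.
by left; rewrite ffunE eqxx /= qj modnn.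
Qed.


(** Direction [j] is stepped last and that step is omitted, so all vertices involved stay in the
    face where coordinate [j] is [0] or [n]. There [g] vanishes if [j = i]; otherwise label [j] is
    constant and its increment is zero. *)
Lemma kuhn_skip_last0 (m n : nat) (i : 'I_m.+1)
    (l : 'I_m.+1 -> ('I_m.+1 -> nat) -> int) (g : ('I_m.+1 -> nat) -> int)
    (t : 'S_m.+1) (q : 'I_m.+1 -> nat) (j : 'I_m.+1) :
  (forall x, x i = 0%N \/ x i = n -> g x = 0) ->
  (forall k x, x k = 0%N -> l k x = 0) ->
  (forall k x, x k = n -> l k x = n%:R) ->
  t j = ord_max -> q j = 0%N \/ q j = n ->
  g (kuhn_vertex t q i) * kuhn_skip i l t q m = 0.
Proof.
move=> g0 l0 ln tj qj.
have vertj k : (k <= m)%N -> kuhn_vertex t q k j = q j.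
  by move=> km; rewrite /kuhn_vertex tj /= ltnNge km addn0.
have [ij|/unlift_some[k jE _]] := eqVneq i j.
  by rewrite g0 ?mul0r // ij vertj // -ltnS ltn_ord.
rewrite /kuhn_skip (bigD1 k) //= -jE /kuhn_edge /bump leqNgt ltn_ord add0n.
have vk := vertj k (ltnW (ltn_ord k)); have vSk := vertj k.+1 (ltn_ord k).
case: qj => qj; first by rewrite !l0 ?vk ?vSk // subrr mul0r mulr0.
by rewrite !ln ?vk ?vSk // subrr mul0r mulr0.
Qed.

Definition kuhn_sum (m n : nat) (l : 'I_m -> ('I_m -> nat) -> int) : int :=
  \sum_(q : {ffun 'I_m -> 'I_n}) \sum_(t : 'S_m) (-1) ^+ odd_perm t *
    \prod_(i < m) kuhn_edge (l i) t (fun j => q j) i.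

(** Discrete Stokes: the increment of [g] on step [i] splits into its values at vertices [i.+1] and
    [i]. Moving the omitted step to [0] in the first part and to [m] in the second makes them
    translates of each other by [kuhn_cycle], so the sum over the boxes telescopes to faces where
    the terms vanish. *)
Lemma kuhn_sum_boundary0 (m n : nat) (i : 'I_m.+1)
    (l : 'I_m.+1 -> ('I_m.+1 -> nat) -> int) (g : ('I_m.+1 -> nat) -> int) :
  (forall x, x i = 0%N \/ x i = n -> g x = 0) ->
  (forall k x, x k = 0%N -> l k x = 0) ->
  (forall k x, x k = n -> l k x = n%:R) ->
  kuhn_sum n (fun k => if k == i then g else l k) = 0.
Proof.
move=> g0 l0 ln; rewrite /kuhn_sum.
pose A (q : 'I_m.+1 -> nat) c s := \sum_(t : 'S_m.+1) (-1) ^+ odd_perm t *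
  (g (kuhn_vertex t q c) * kuhn_skip i l t q s).
have im : (i <= m)%N by rewrite -ltnS ltn_ord.
have AE (q : 'I_m.+1 -> nat) :
    \sum_(t : 'S_m.+1) (-1) ^+ odd_perm t * \prod_(k < m.+1)
      kuhn_edge (if k == i then g else l k) t q k =
    (-1) ^+ i * (A q i.+1 0 - (-1) ^+ m * A q i m).
  have -> : A q i m = (-1) ^+ (m - i) * A q i i.
    by have := @kuhn_skip_up m i l g q i i (m - i); rewrite subnKC // !leqnn => /(_ isT isT).
  rewrite [(-1) ^+ m * _]mulrA -exprD.
  have -> : (m + (m - i) = (m - i).*2 + i)%N by rewrite -addnn; lia.
  rewrite exprD -muln2 exprM sqrr_sign mul1r mulrBr.
  rewrite mulrA -exprD addnn -muln2 exprM sqrr_sign mul1r.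
  have := @kuhn_skip_up m i l g q i.+1 0 i.
  rewrite add0n ltnSn => /(_ im isT); rewrite -/(A q _ _) => <-.
  rewrite -sumrB; apply: eq_bigr => t _; rewrite -mulrBr; congr (_ * _).
  rewrite (bigD1_ord i) //= eqxx /kuhn_skip /kuhn_edge -mulrBl; congr (_ * _).
  by apply: eq_bigr => k _; rewrite eq_sym (negbTE (neq_lift _ _)).
under eq_bigr do rewrite AE /A kuhn_cycle -mulrBr mulrA.
rewrite -big_distrr /= sumrB [X in X - _]exchange_big [X in _ - X]exchange_big.
rewrite -sumrB big1 ?mulr0 // => t _; rewrite -!big_distrr -mulrBr /=.
(* The direction of the translation depends on [t], hence the exchange of sums: [t] is fixed before
   summing over the boxes. *)
pose j := (t^-1)%g ord_max; have tj : t j = ord_max by rewrite permKV.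
have tj' k : (t k == ord_max) = (k == j) by rewrite -tj (inj_eq perm_inj).
under eq_bigr do under [fun k => (_ + _)%N]funext do rewrite tj'.
rewrite (@big_shift_coord _ _ j (fun q =>
  g (kuhn_vertex t q i) * kuhn_skip i l t q m)) ?subrr ?mulr0 // => q qj.
exact: (kuhn_skip_last0 g0 l0 ln tj).
Qed.

Lemma kuhn_sumB (m n : nat) (i : 'I_m) (l : 'I_m -> ('I_m -> nat) -> int)
    (g h : ('I_m -> nat) -> int) :
  kuhn_sum n (fun k => if k == i then fun x => g x - h x else l k) =
  kuhn_sum n (fun k => if k == i then g else l k) -
  kuhn_sum n (fun k => if k == i then h else l k).
Proof.
rewrite /kuhn_sum -sumrB; apply: eq_bigr => q _; rewrite -sumrB.
apply: eq_bigr => t _; rewrite -mulrBr; congr (_ * _).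
have split_i f : \prod_(k < m) kuhn_edge (if k == i then f else l k) t
    (fun j => q j) k =
    kuhn_edge f t (fun j => q j) i *
    \prod_(k < m | k != i) kuhn_edge (l k) t (fun j => q j) k.
  rewrite (bigD1 i) //= eqxx; congr (_ * _); apply: eq_bigr => k ki.
  by rewrite (negbTE ki).
by rewrite !split_i -mulrBl /kuhn_edge; congr (_ * _); ring.
Qed.

(** On step [i] coordinate [i] grows by one if [t i = i] and stays put otherwise, so only the
    identity contributes, once per box. *)
Lemma kuhn_sum_coord (m n : nat) :
  kuhn_sum n (fun (i : 'I_m) x => (x i)%:R) = (n ^ m)%:R.
Proof.
rewrite /kuhn_sum (eq_bigr (fun=> 1)) => [|q _].
  by rewrite sumr_const card_ffun !card_ord.
rewrite (bigD1 1%g) //= odd_perm1 mul1r big1 => [|i _].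
  rewrite big1 ?addr0 // => t t1.
  have [i ti] : exists i, t i != i.
    apply/existsP; apply: contra_neqT t1 => /existsPn tid.
    by apply/permP => i; rewrite perm1; apply/eqP; rewrite -[_ == _]negbK tid.
  rewrite (bigD1 i) //= /kuhn_edge /kuhn_vertex ltnS leq_eqVlt val_eqE.
  by rewrite (negbTE ti) subrr mul0r mulr0.
rewrite /kuhn_edge /kuhn_vertex perm1 ltnSn ltnn addn0 addn1.
by rewrite -natr1 addrC addKr.
Qed.

(** The labels are replaced by coordinates one at a time. Label [r] and coordinate [r] agree on the
    two faces orthogonal to direction [r], so by linearity and [kuhn_sum_boundary0] the sum does not
    change. *)
Lemma kuhn_sumE (m n : nat) (l : 'I_m.+1 -> ('I_m.+1 -> nat) -> int) :
  (forall k x, x k = 0%N -> l k x = 0) ->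
  (forall k x, x k = n -> l k x = n%:R) ->
  kuhn_sum n l = (n ^ m.+1)%:R.
Proof.
move=> l0 ln.
pose hyb r : 'I_m.+1 -> ('I_m.+1 -> nat) -> int :=
  fun k x => if (k < r)%N then (x k)%:R else l k x.
suff hybE r : (r <= m.+1)%N -> kuhn_sum n (hyb r) = kuhn_sum n l.
  rewrite -(hybE m.+1) // -kuhn_sum_coord; congr kuhn_sum.
  by apply/funext => k; apply/funext => x; rewrite /hyb ltn_ord.
elim: r => [|r IH] rm.
  by congr kuhn_sum; apply/funext => k; apply/funext => x.
rewrite -(IH (ltnW rm)); pose i := Ordinal rm.
have hyb0 k x : x k = 0%N -> hyb r k x = 0.
  by move=> xk; rewrite /hyb xk l0 //; case: ifP.
have hybn k x : x k = n -> hyb r k x = n%:R.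
  by move=> xk; rewrite /hyb xk ln //; case: ifP.
have g0 x : x i = 0%N \/ x i = n -> hyb r i x - (x i)%:R = 0.
  by case=> xi; [rewrite hyb0 | rewrite hybn]; rewrite // xi ?mulr0n subrr.
have := kuhn_sum_boundary0 g0 hyb0 hybn.
rewrite (kuhn_sumB n i (hyb r) (hyb r i) (fun x => (x i)%:R)).
move/eqP; rewrite subr_eq0 => /eqP hE.
transitivity (kuhn_sum n (fun k => if k == i then fun x => (x i)%:R else hyb r k)).
  congr kuhn_sum; apply/funext => k; apply/funext => x; rewrite /hyb ltnS leq_eqVlt.
  have [->|ki] := eqVneq k i; first by rewrite eqxx.
  by rewrite -[(k : nat) == r]/(k == i) (negbTE ki).
rewrite -hE; congr kuhn_sum; apply/funext => k; apply/funext => x.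
by case: eqP => // ->.
Qed.

(** With label [n] where [P k] holds and [0] elsewhere, the Kuhn sum is nonzero, so some simplex has
    a nonzero product: every label changes along one of its edges, and all its vertices lie in one
    box. *)
Lemma discrete_poincare_miranda (m n : nat)
    (P : 'I_m.+1 -> ('I_m.+1 -> nat) -> bool) :
  (0 < n)%N ->
  (forall k x, x k = 0%N -> ~~ P k x) -> (forall k x, x k = n -> P k x) ->
  exists q : 'I_m.+1 -> nat, (forall k, q k < n)%N /\
    forall k, exists x y,
      [/\ forall j, (q j <= x j <= (q j).+1)%N,
          forall j, (q j <= y j <= (q j).+1)%N, ~~ P k x & P k y].
Proof.
move=> n0 P0 Pn; pose l k x : int := if P k x then n%:R else 0.
have : kuhn_sum n l != 0.
  rewrite kuhn_sumE => [|k x xk|k x xk]; last 2 first.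
  - by rewrite /l (negbTE (P0 _ _ xk)).
  - by rewrite /l Pn.
  by rewrite pnatr_eq0 -lt0n expn_gt0 n0.
move=> S_neq0; apply: contra_neqP S_neq0 => noq.
rewrite /kuhn_sum big1 // => q _; rewrite big1 // => t _; apply/eqP.
rewrite mulf_eq0 signr_eq0 /=; apply: contra_notT noq => /prodf_neq0 edge.
exists (fun j => q j : nat); split => [k|k]; first exact: ltn_ord.
have vert_box c j : (q j <= kuhn_vertex t (fun j => q j : nat) c j <= (q j).+1)%N.
  by rewrite /kuhn_vertex leq_addr -[(q j).+1]addn1 leq_add2l leq_b1.
have := edge k isT; rewrite /kuhn_edge /l.
set x := kuhn_vertex t _ k; set y := kuhn_vertex t _ k.+1.
case: (boolP (P k y)) => Py; case: (boolP (P k x)) => Px; rewrite ?subrr ?eqxx //.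
  by exists x, y; split=> // j; exact: vert_box.
by exists y, x; split=> // j; exact: vert_box.
Qed.

(** * Sequential choice and softmax *)

Definition ffun_rcons (n : nat) (T : finType) (B : {ffun 'I_n -> T}) (x : T) :
    {ffun 'I_n.+1 -> T} :=
  [ffun k => if unlift ord_max k is Some k' then B k' else x].

Lemma ffun_rcons_widen (n : nat) (T : finType) (B : {ffun 'I_n -> T}) (x : T)
    (k : 'I_n) :
  ffun_rcons B x (widen_ord (leqnSn n) k) = B k.
Proof.
rewrite ffunE; have -> : widen_ord (leqnSn n) k = lift ord_max k.
  by apply/val_inj; rewrite /= /bump leqNgt ltn_ord.
by rewrite liftK.
Qed.

Lemma ffun_rcons_max (n : nat) (T : finType) (B : {ffun 'I_n -> T}) (x : T) :
  ffun_rcons B x ord_max = x.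
Proof. by rewrite ffunE unlift_none. Qed.

Lemma ffun_rcons_bij (n : nat) (T : finType) :
  bijective (fun Bx : {ffun 'I_n -> T} * T => ffun_rcons Bx.1 Bx.2).
Proof.
exists (fun B : {ffun 'I_n.+1 -> T} =>
  ([ffun k => B (widen_ord (leqnSn n) k)], B ord_max)) => [[B x]|B] /=.
  rewrite ffun_rcons_max; congr pair.
  by apply/ffunP => k; rewrite ffunE ffun_rcons_widen.
apply/ffunP => k; rewrite ffunE; case: unliftP => [k' ->|-> //].
by rewrite ffunE; congr (B _); apply/val_inj; rewrite /= /bump leqNgt ltn_ord.
Qed.

(** [F i B] plays the conditional law of pick [i] given the earlier picks. Summing out the last pick
    first leaves a shorter chain, whence the induction on [n]. *)
Lemma chain_bounds (R : numDomainType) (n : nat) (T : finType) (x0 : T)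
    (F : 'I_n -> {ffun 'I_n -> T} -> T -> R) (a b : 'I_n -> R) :
  (forall (i : 'I_n) (B B' : {ffun 'I_n -> T}),
     (forall k : 'I_n, (k < i)%N -> B k = B' k) -> F i B = F i B') ->
  (forall i B x, 0 <= F i B x) -> (forall i, 0 <= a i) ->
  (forall i B, a i <= \sum_x F i B x <= b i) ->
  \prod_i a i <= \sum_B \prod_i F i B (B i) <= \prod_i b i.
Proof.
elim: n F a b => [|n IH] F a b Fdep F0 a0 Fab.
  rewrite !big_ord0 (eq_bigr (fun=> 1)) => [|B _]; last by rewrite big_ord0.
  by rewrite sumr_const card_ffun card_ord expn0 lexx.
pose w := widen_ord (leqnSn n).
(* [x0] is a dummy last pick, on which the earlier factors do not depend. *)
pose F' i B := F (w i) (ffun_rcons B x0).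
have FE B x i : F (w i) (ffun_rcons B x) = F' i B.
  apply: Fdep => k ki; have kn : (k < n)%N by exact: ltn_trans ki (ltn_ord i).
  have -> : k = w (Ordinal kn) by exact/val_inj.
  by rewrite !ffun_rcons_widen.
have FmaxE B x : F ord_max (ffun_rcons B x) = F ord_max (ffun_rcons B x0).
  apply: Fdep => k kn.
  have -> : k = w (Ordinal kn) by exact/val_inj.
  by rewrite !ffun_rcons_widen.
have sumE : \sum_B \prod_i F i B (B i) =
    \sum_B (\prod_i F' i B (B i)) * \sum_x F ord_max (ffun_rcons B x0) x.
  rewrite (reindex _ (onW_bij _ (@ffun_rcons_bij n T))) /=.
  under [RHS]eq_bigr do rewrite big_distrr /=.
  rewrite pair_bigA; apply: eq_bigr => -[B x] _ /=.
  rewrite big_ord_recr /= ffun_rcons_max FmaxE; congr (_ * _).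
  by apply: eq_bigr => i _; rewrite FE ffun_rcons_widen.
have /andP[IHa IHb] : \prod_i a (w i) <= \sum_B \prod_i F' i B (B i)
    <= \prod_i b (w i).
  apply: IH => [i B B' BB'|i B x|i|i B]; rewrite /F' //.
  apply: Fdep => k ki; have kn : (k < n)%N by exact: ltn_trans ki (ltn_ord i).
  have -> : k = w (Ordinal kn) by exact/val_inj.
  by rewrite !ffun_rcons_widen; exact: BB'.
have prod0 B : 0 <= \prod_i F' i B (B i) by apply: prodr_ge0 => i _; exact: F0.
rewrite sumE !big_ord_recr /=; apply/andP; split.
  apply: (@le_trans _ _ (\sum_B (\prod_i F' i B (B i)) * a ord_max)).
    by rewrite -big_distrl /= ler_wpM2r.
  by apply: ler_sum => B _; rewrite ler_wpM2l //; case/andP: (Fab ord_max (ffun_rcons B x0)).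
apply: (@le_trans _ _ (\sum_B (\prod_i F' i B (B i)) * b ord_max)).
  by apply: ler_sum => B _; rewrite ler_wpM2l //; case/andP: (Fab ord_max (ffun_rcons B x0)).
rewrite -big_distrl /= ler_wpM2r //.
by case/andP: (Fab ord_max [ffun=> x0]) => sa; apply: le_trans; apply: le_trans sa; exact: a0.
Qed.

Lemma chain_total (R : numDomainType) (n : nat) (T : finType) (x0 : T)
    (F : 'I_n -> {ffun 'I_n -> T} -> T -> R) :
  (forall (i : 'I_n) (B B' : {ffun 'I_n -> T}),
     (forall k : 'I_n, (k < i)%N -> B k = B' k) -> F i B = F i B') ->
  (forall i B x, 0 <= F i B x) -> (forall i B, \sum_x F i B x = 1) ->
  \sum_B \prod_i F i B (B i) = 1.
Proof.
move=> Fdep F0 F1; apply/eqP; rewrite eq_le andbC.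
have := @chain_bounds R n T x0 F (fun=> 1) (fun=> 1) Fdep F0.
rewrite big1 //; apply=> // i B; rewrite F1 lexx //.
Qed.

(** The indicator of [Q] is absorbed into factor [i0]; every other factor keeps total mass one. *)
Lemma chain_marginal (R : numDomainType) (n : nat) (T : finType) (x0 : T)
    (F : 'I_n -> {ffun 'I_n -> T} -> T -> R) (i0 : 'I_n) (Q : pred T) (a b : R) :
  (forall (i : 'I_n) (B B' : {ffun 'I_n -> T}),
     (forall k : 'I_n, (k < i)%N -> B k = B' k) -> F i B = F i B') ->
  (forall i B x, 0 <= F i B x) -> (forall i B, \sum_x F i B x = 1) ->
  0 <= a -> (forall B, a <= \sum_(x | Q x) F i0 B x <= b) ->
  a <= \sum_(B : {ffun 'I_n -> T} | Q (B i0)) \prod_i F i B (B i) <= b.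
Proof.
move=> Fdep F0 F1 a0 Fab.
pose G i B x := F i B x * ((i == i0) ==> Q x)%:R.
have := @chain_bounds R n T x0 G (fun i => if i == i0 then a else 1)
  (fun i => if i == i0 then b else 1).
rewrite -!big_mkcond !big_pred1_eq.
have -> : \sum_(B : {ffun 'I_n -> T} | Q (B i0)) \prod_i F i B (B i) =
    \sum_B \prod_i G i B (B i).
  rewrite big_mkcond; apply: eq_bigr => B _; rewrite /G big_split /=.
  rewrite [X in _ * X](bigD1 i0) //= eqxx /= [X in _ * (_ * X)]big1 ?mulr1.
    by case: (Q _); rewrite ?mulr1 ?mulr0.
  by move=> i /negbTE ->.
apply=> [i B B' BB'|i B x|i|i B].
- by rewrite /G (Fdep _ _ _ BB').
- by rewrite mulr_ge0.
- by case: ifP.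
case: eqP => [->|/eqP/negbTE ii0]; last first.
  rewrite (eq_bigr (F i B)) => [|x _]; first by rewrite F1 lexx.
  by rewrite /G ii0 mulr1.
suff -> : \sum_x G i0 B x = \sum_(x | Q x) F i0 B x by [].
rewrite [RHS]big_mkcond; apply: eq_bigr => x _; rewrite /G eqxx /=.
by case: (Q x); rewrite ?mulr1 ?mulr0.
Qed.

Definition softmax (R : realType) (T : finType) (b : R) (w : T -> R)
    (S : {set T}) (x : T) : R :=
  if x \in S then expR (b * w x) / \sum_(y in S) expR (b * w y) else 0.

Lemma sum_expR_gt0 (R : realType) (T : finType) (w : T -> R) (S : {set T}) (x : T) :
  x \in S -> 0 < \sum_(y in S) expR (w y).
Proof.
move=> xS; rewrite (bigD1 x) //= ltr_pwDl ?expR_gt0 //.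
by apply: sumr_ge0 => y _; exact: expR_ge0.
Qed.

Lemma softmax_ge0 (R : realType) (T : finType) (b : R) (w : T -> R) (S : {set T})
    (x : T) : 0 <= softmax b w S x.
Proof.
rewrite /softmax; case: ifP => // _; rewrite divr_ge0 ?expR_ge0 //.
by apply: sumr_ge0 => y _; exact: expR_ge0.
Qed.

Lemma softmax_sum1 (R : realType) (T : finType) (b : R) (w : T -> R)
    (S : {set T}) : S != finset.set0 -> \sum_(x in S) softmax b w S x = 1.
Proof.
case/set0Pn => x xS; rewrite /softmax -big_mkcondr /=.
under eq_bigl do rewrite andbb.
by rewrite -big_distrl /= divff // gt_eqF // (sum_expR_gt0 _ xS).
Qed.

Lemma softmax_sumT (R : realType) (T : finType) (b : R) (w : T -> R)
    (S : {set T}) : S != finset.set0 -> \sum_x softmax b w S x = 1.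
Proof.
move=> S0; rewrite -(softmax_sum1 b w S0) [RHS]big_mkcond /=.
by apply: eq_bigr => x _; rewrite /softmax; case: ifP.
Qed.

Lemma softmax_le1 (R : realType) (T : finType) (b : R) (w : T -> R) (S : {set T})
    (x : T) : softmax b w S x <= 1.
Proof.
have [xS|xS] := boolP (x \in S); last by rewrite /softmax (negbTE xS).
have S0 : S != finset.set0 by apply/set0Pn; exists x.
rewrite -(softmax_sum1 b w S0) (bigD1 x) //= lerDl.
by apply: sumr_ge0 => y _; exact: softmax_ge0.
Qed.

Lemma softmax_ratio (R : realType) (T : finType) (b : R) (w : T -> R)
    (S : {set T}) (x y : T) : x \in S -> y \in S ->
  softmax b w S x = expR (b * (w x - w y)) * softmax b w S y.
Proof.
by move=> xS yS; rewrite /softmax xS yS mulrA -expRD mulrBr subrK.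
Qed.

Lemma softmax_le_gap (R : realType) (T : finType) (b : R) (w : T -> R)
    (S : {set T}) (x y : T) : y \in S ->
  softmax b w S x <= expR (b * (w x - w y)).
Proof.
move=> yS; have [xS|xS] := boolP (x \in S); last first.
  by rewrite /softmax (negbTE xS) expR_ge0.
by rewrite (softmax_ratio b w xS yS) ler_piMr ?expR_ge0 ?softmax_le1.
Qed.

(** Weights do not depend on the choice set, so conditioning on [E] only changes the normalization.
    It is used with [E] a demand set. *)
Lemma softmax_subset (R : realType) (T : finType) (b : R) (w : T -> R)
    (S E : {set T}) (x : T) : E \subset S -> x \in E ->
  softmax b w S x = softmax b w E x * \sum_(y in E) softmax b w S y.
Proof.
move=> /fintype.subsetP ES xE; rewrite /softmax xE (ES _ xE).
have -> : \sum_(y in E) (if y \in S then expR (b * w y) /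
      \sum_(y0 in S) expR (b * w y0) else 0) =
    (\sum_(y in E) expR (b * w y)) / \sum_(y in S) expR (b * w y).
  by rewrite big_distrl; apply: eq_bigr => y /ES ->.
rewrite mulrA; congr (_ / _); rewrite divfK // gt_eqF //.
exact: (sum_expR_gt0 (fun y => b * w y) xE).
Qed.

(** The common factor [expR (b * c)] cancels. This removes the valuation from the softmax on a
    demand set. *)
Lemma eq_softmaxD (R : realType) (T : finType) (b c : R) (w w' : T -> R)
    (S : {set T}) : (forall x, x \in S -> w' x = c + w x) ->
  softmax b w' S =1 softmax b w S.
Proof.
move=> ww' x; rewrite /softmax; case: ifP => // xS.
under eq_bigr => y yS do rewrite (ww' _ yS) mulrDr expRD.
rewrite ww' // mulrDr expRD -big_distrr /= invfM mulrACA divff ?mul1r //.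
by rewrite gt_eqF // expR_gt0.
Qed.

(** Numerator and denominator each change by a factor of at most [expR (b * d)], hence the [2]. *)
Lemma softmax_stable (R : realType) (T : finType) (b d : R) (w w' : T -> R)
    (S : {set T}) (x : T) : 0 <= b -> (forall y, `|w y - w' y| <= d) ->
  softmax b w' S x <= expR (2 * b * d) * softmax b w S x.
Proof.
move=> b0 ww'; rewrite /softmax; case: ifPn => xS; last by rewrite mulr0.
have exp_le u u' : (forall y, `|u y - u' y| <= d) ->
    forall y : T, expR (b * u' y) <= expR (b * d) * expR (b * u y).
  move=> uu' y; rewrite -expRD ler_expR -mulrDr ler_wpM2l //.
  by have := uu' y; rewrite ler_norml => /andP[]; lra.
have sum_le : \sum_(y in S) expR (b * w y) <=
    expR (b * d) * \sum_(y in S) expR (b * w' y).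
  rewrite big_distrr /=; apply: ler_sum => y _; apply: exp_le => z.
  by rewrite distrC.
have s0 : 0 < \sum_(y in S) expR (b * w y) by exact: (sum_expR_gt0 (fun y => b * w y) xS).
have s0' : 0 < \sum_(y in S) expR (b * w' y) by exact: (sum_expR_gt0 (fun y => b * w' y) xS).
have -> : expR (2 * b * d) = expR (b * d) * expR (b * d).
  by rewrite -expRD; congr expR; lra.
rewrite mulrA ler_pdivrMr // mulrAC ler_pdivlMr //.
apply: le_trans (ler_pM (expR_ge0 _) (ltW s0) (exp_le _ _ ww' x) sum_le) _.
by rewrite le_eqVlt; apply/orP; left; apply/eqP; ring.
Qed.

Lemma demand_neq0 (R : realType) (m : nat) (v : valuation R m) (p : 'rV[R]_m)
    (M : {set 'I_m}) : demand v p M != finset.set0.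
Proof.
case: (@Order.TotalTheory.arg_maxP _ _ _ (finset.set0 : {set 'I_m})
  (fun B => B \subset M) (utility v p) (finset.sub0set M)) => B BM Bmax.
apply/set0Pn; exists B; rewrite inE BM; apply/forallP => B'.
by apply/implyP => /Bmax.
Qed.

(** * Sale probabilities under sequential softmax choices *)

Definition smooth_outcome (R : realType) (n m : nat) (b : R)
    (v : 'I_n -> valuation R m) (p : 'rV[R]_m)
    (B : {ffun 'I_n -> {set 'I_m}}) : R :=
  \prod_(i < n) softmax b (utility (v i) p) (powerset (available B i)) (B i).

Definition smooth_item (R : realType) (n m : nat) (b : R)
    (v : 'I_n -> valuation R m) (p : 'rV[R]_m) (j : 'I_m) : R :=
  \sum_(B : {ffun 'I_n -> {set 'I_m}} | j \in (\bigcup_(i < n) B i)%SET)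
    smooth_outcome b v p B.

Lemma powerset_neq0 (T : finType) (S : {set T}) : powerset S != finset.set0.
Proof. by apply/set0Pn; exists finset.set0; rewrite inE finset.sub0set. Qed.

Lemma eq_available (n m : nat) (i : 'I_n) (B B' : {ffun 'I_n -> {set 'I_m}}) :
  (forall k : 'I_n, (k < i)%N -> B k = B' k) -> available B i = available B' i.
Proof.
by move=> BB'; rewrite /available; congr (~: _)%SET; apply: eq_bigr => k /BB'.
Qed.

Lemma smooth_outcome_ge0 (R : realType) (n m : nat) (b : R)
    (v : 'I_n -> valuation R m) (p : 'rV[R]_m) B : 0 <= smooth_outcome b v p B.
Proof. by apply: prodr_ge0 => i _; exact: softmax_ge0. Qed.

Lemma smooth_item_ge0 (R : realType) (n m : nat) (b : R)
    (v : 'I_n -> valuation R m) (p : 'rV[R]_m) j : 0 <= smooth_item b v p j.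
Proof. by apply: sumr_ge0 => B _; exact: smooth_outcome_ge0. Qed.

Lemma smooth_outcome_marginal (R : realType) (n m : nat) (b : R)
    (v : 'I_n -> valuation R m) (p : 'rV[R]_m) (i : 'I_n)
    (Q : pred {set 'I_m}) (x y : R) : 0 <= x ->
  (forall B : {ffun 'I_n -> {set 'I_m}},
    x <= \sum_(C | Q C)
      softmax b (utility (v i) p) (powerset (available B i)) C <= y) ->
  x <= \sum_(B : {ffun 'I_n -> {set 'I_m}} | Q (B i)) smooth_outcome b v p B <= y.
Proof.
apply: (@chain_marginal R n {set 'I_m} finset.set0 (fun i B =>
  softmax b (utility (v i) p) (powerset (available B i)))).
- by move=> k B B' /eq_available ->.
- by move=> k B C; exact: softmax_ge0.
- by move=> k B; rewrite softmax_sumT ?powerset_neq0.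
Qed.

Lemma smooth_item_le1 (R : realType) (n m : nat) (b : R)
    (v : 'I_n -> valuation R m) (p : 'rV[R]_m) j : smooth_item b v p j <= 1.
Proof.
have <- : \sum_B smooth_outcome b v p B = 1.
  apply: (@chain_total R n {set 'I_m} finset.set0 (fun i B =>
    softmax b (utility (v i) p) (powerset (available B i)))).
  - by move=> k B B' /eq_available ->.
  - by move=> k B C; exact: softmax_ge0.
  - by move=> k B; rewrite softmax_sumT ?powerset_neq0.
rewrite [leRHS](bigID (fun B : {ffun 'I_n -> {set 'I_m}} =>
  j \in (\bigcup_(i < n) B i)%SET)) /= lerDl.
by apply: sumr_ge0 => B _; exact: smooth_outcome_ge0.
Qed.

Lemma utility_setU1 (R : realType) (m : nat) (v : valuation R m) (p : 'rV[R]_m)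
    (j : 'I_m) (B : {set 'I_m}) : j \notin B ->
  utility v p (j |: B)%SET - utility v p B = v (j |: B)%SET - v B - p ord0 j.
Proof. by move=> jB; rewrite /utility big_setU1 //=; ring. Qed.

Lemma sum_setU1 (R : zmodType) (m : nat) (j : 'I_m) (F : {set 'I_m} -> R) :
  \sum_(C : {set 'I_m} | j \in C) F C =
  \sum_(C : {set 'I_m} | j \notin C) F (j |: C)%SET.
Proof.
rewrite (reindex_onto (fun C : {set 'I_m} => (j |: C)%SET)
  (fun C : {set 'I_m} => (C :\ j)%SET)) /=; last by move=> C jC; rewrite finset.setD1K.
apply: eq_bigl => C; rewrite setU11 /=; apply/eqP/idP => [<-|]; last exact: finset.setU1K.
by rewrite finset.setD11.
Qed.

(** Each bundle [C] without [j] is paired with [j |: C], which by monotonicity has at least the same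
    utility when [j] is free, hence at least the same weight. *)
Lemma softmax_item_ge_half (R : realType) (m : nat) (b : R) (v : valuation R m)
    (p : 'rV[R]_m) (j : 'I_m) (M : {set 'I_m}) :
  0 <= b -> p ord0 j = 0 -> j \in M ->
  2^-1 <= \sum_(C : {set 'I_m} | j \in C) softmax b (utility v p) (powerset M) C.
Proof.
move=> b0 pj jM; set f := softmax _ _ _.
have f1 : \sum_(C : {set 'I_m} | j \in C) f C + \sum_(C : {set 'I_m} | j \notin C) f C = 1.
  by rewrite -(softmax_sumT b (utility v p) (powerset_neq0 M)) [RHS](bigID (fun C : {set 'I_m} => j \in C)).
suff : \sum_(C : {set 'I_m} | j \notin C) f C <= \sum_(C : {set 'I_m} | j \in C) f C by lra.
rewrite [leRHS]sum_setU1; apply: ler_sum => C jC.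
have [CM|CM] := boolP (C \in powerset M); last first.
  by rewrite {1}/f /softmax (negbTE CM) softmax_ge0.
have jCM : (j |: C)%SET \in powerset M.
  by move: CM; rewrite !inE finset.subUset finset.sub1set jM.
rewrite [leRHS](softmax_ratio b _ jCM CM) ler_peMl ?softmax_ge0 //.
rewrite -expR0 ler_expR mulr_ge0 // utility_setU1 // pj subr0 subr_ge0.
by apply: valuation_mono; exact: finset.subsetUr.
Qed.

(** In the same pairing, adding [j] gains at most [v [set: 'I_m]] and costs [p ord0 j], so utility
    drops by at least [c]. *)
Lemma softmax_item_le (R : realType) (m : nat) (b c : R) (v : valuation R m)
    (p : 'rV[R]_m) (j : 'I_m) (M : {set 'I_m}) :
  0 <= b -> v [set: 'I_m]%SET + c <= p ord0 j ->
  \sum_(C : {set 'I_m} | j \in C) softmax b (utility v p) (powerset M) C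
    <= expR (- (b * c)).
Proof.
move=> b0 pj; rewrite sum_setU1.
apply: (@le_trans _ _ (expR (- (b * c)) * \sum_(C : {set 'I_m} | j \notin C)
    softmax b (utility v p) (powerset M) C)); last first.
  rewrite ler_piMr ?expR_ge0 //.
  rewrite -(softmax_sumT b (utility v p) (powerset_neq0 M)).
  rewrite [leRHS](bigID (fun C : {set 'I_m} => j \notin C)) /= lerDl.
  by apply: sumr_ge0 => C _; exact: softmax_ge0.
rewrite big_distrr /=; apply: ler_sum => C jC.
have [jCM|jCM] := boolP ((j |: C)%SET \in powerset M); last first.
  by rewrite {1}/softmax (negbTE jCM) mulr_ge0 ?expR_ge0 ?softmax_ge0.
have CM : C \in powerset M.
  by move: jCM; rewrite !inE finset.subUset => /andP[].
rewrite (softmax_ratio b _ jCM CM) ler_wpM2r ?softmax_ge0 //.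
rewrite ler_expR utility_setU1 // -mulrN ler_wpM2l //.
have vT : v (j |: C)%SET <= v [set: 'I_m]%SET by apply: valuation_mono; exact: finset.subsetT.
by have := valuation_ge0 v C; lra.
Qed.

(** The first agent finds all items available and already takes [j] with probability at least
    1/2. *)
Lemma smooth_item_ge_half (R : realType) (n m : nat) (b : R)
    (v : 'I_n -> valuation R m) (p : 'rV[R]_m) (j : 'I_m) :
  (0 < n)%N -> 0 <= b -> p ord0 j = 0 -> 2^-1 <= smooth_item b v p j.
Proof.
move=> n0 b0 pj; pose i0 := Ordinal n0.
have /andP[half _] : 2^-1 <= \sum_(B : {ffun 'I_n -> {set 'I_m}} | j \in B i0)
    smooth_outcome b v p B <= 1.
  apply: (@smooth_outcome_marginal R n m b v p i0 (fun C => j \in C)).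
    by rewrite invr_ge0.
  move=> B; apply/andP; split.
    apply: softmax_item_ge_half => //.
    by rewrite /available big_pred0 ?finset.setC0 ?inE.
  rewrite -(softmax_sumT b (utility (v i0) p) (powerset_neq0 (available B i0))).
  rewrite [leRHS](bigID (fun C : {set 'I_m} => j \in C)) /= lerDl.
  by apply: sumr_ge0 => C _; exact: softmax_ge0.
apply: (le_trans half); rewrite /smooth_item big_mkcond [leRHS]big_mkcond /=.
apply: ler_sum => B _; case: ifPn => jB.
  by rewrite (_ : (j \in _)%SET) //; apply/finset.bigcupP; exists i0.
by case: ifP => // _; exact: smooth_outcome_ge0.
Qed.

(** A union bound over the agent who takes [j]. *)
Lemma smooth_item_le (R : realType) (n m : nat) (b c : R)
    (v : 'I_n -> valuation R m) (p : 'rV[R]_m) (j : 'I_m) : 0 <= b ->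
  (forall i, v i [set: 'I_m]%SET + c <= p ord0 j) ->
  smooth_item b v p j <= n%:R * expR (- (b * c)).
Proof.
move=> b0 pj.
apply: (@le_trans _ _ (\sum_(i < n) \sum_(B : {ffun 'I_n -> {set 'I_m}} | j \in B i)
    smooth_outcome b v p B)).
  under [leRHS]eq_bigr do rewrite big_mkcond.
  rewrite [leRHS]exchange_big /smooth_item big_mkcond /=.
  apply: ler_sum => B _; case: ifPn => [/finset.bigcupP[i _ jBi]|_].
    rewrite (bigD1 i) //= jBi lerDl sumr_ge0 // => k _.
    by case: ifP => // _; exact: smooth_outcome_ge0.
  apply: sumr_ge0 => k _.
  by case: ifP => // _; exact: smooth_outcome_ge0.
rewrite mulr_natl -[X in _ *+ X](card_ord n) -sumr_const; apply: ler_sum => i _.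
suff /andP[] : 0 <= \sum_(B : {ffun 'I_n -> {set 'I_m}} | j \in B i)
    smooth_outcome b v p B <= expR (- (b * c)) by [].
apply: (@smooth_outcome_marginal R n m b v p i (fun C => j \in C)) => // B.
rewrite softmax_item_le // andbT.
by apply: sumr_ge0 => C _; exact: softmax_ge0.
Qed.

(** A bundle has at most [m] items, so utilities move by at most [d * m]; there is one softmax
    factor for each of the [n] agents. *)
Lemma smooth_item_stable (R : realType) (n m : nat) (b d : R)
    (v : 'I_n -> valuation R m) (p p' : 'rV[R]_m) (j : 'I_m) : 0 <= b ->
  (forall k, `|p ord0 k - p' ord0 k| <= d) ->
  smooth_item b v p' j <= expR (2 * b * d * (n * m)%:R) * smooth_item b v p j.
Proof.
move=> b0 pp'; rewrite /smooth_item big_distrr /=; apply: ler_sum => B _.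
apply: (@le_trans _ _ (\prod_(i < n) (expR (2 * b * (d * m%:R)) *
    softmax b (utility (v i) p) (powerset (available B i)) (B i)))).
  apply: ler_prod => i _; rewrite softmax_ge0 /=; apply: softmax_stable => // C.
  have -> : utility (v i) p C - utility (v i) p' C =
      \sum_(k in C) (p' ord0 k - p ord0 k).
    by rewrite /utility sumrB; ring.
  apply: (le_trans (ler_norm_sum _ _ _)).
  apply: (@le_trans _ _ (\sum_(k in C) d)).
    by apply: ler_sum => k _; rewrite distrC.
  rewrite sumr_const -[leLHS]mulr_natr ler_wpM2l ?ler_nat //.
    exact: le_trans (normr_ge0 _) (pp' j).
  by rewrite -[X in (_ <= X)%N](card_ord m) max_card.
rewrite big_split /= prodr_const card_ord -expRM_natl.
rewrite (_ : n%:R * (2 * b * (d * m%:R)) = 2 * b * d * (n * m)%:R) //.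
by rewrite natrM; ring.
Qed.

(** * Approximate medians for softmax choices *)

Lemma measurable_valuation (R : realType) (n m : nat) (i : 'I_n) (S : {set 'I_m}) :
  measurable_fun [set: profile R n m]%classic (fun v : profile R n m => v i S : R).
Proof.
move=> _ Y mY; rewrite setTI; apply: sub_gen_smallest.
by exists (i, S) => //; exists Y => //; rewrite setTI.
Qed.

Lemma measurable_smooth_item (R : realType) (n m : nat) (b : R) (p : 'rV[R]_m)
    (j : 'I_m) :
  measurable_fun [set: profile R n m]%classic
    (fun v : profile R n m => smooth_item b v p j).
Proof.
have mexp i (C : {set 'I_m}) : measurable_fun [set: profile R n m]%classic
    (fun v : profile R n m => expR (b * utility (v i) p C)).
  apply: measurableT_comp => //; apply: measurable_funM => //.
  by apply: measurable_funB => //; exact: measurable_valuation.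
have msum S i : measurable_fun [set: profile R n m]%classic
    (fun v : profile R n m => \sum_(C in S) expR (b * utility (v i) p C)).
  apply: (eq_measurable_fun (fun v : profile R n m =>
    \sum_C if C \in S then expR (b * utility (v i) p C) else 0)).
    by move=> v _; rewrite -big_mkcond.
  by apply: measurable_sum => C; case: (C \in S).
apply: (eq_measurable_fun (fun v : profile R n m =>
    \sum_(B : {ffun 'I_n -> {set 'I_m}}) if j \in (\bigcup_(i < n) B i)%SET
      then smooth_outcome b v p B else 0)).
  by move=> v _; rewrite -big_mkcond.
apply: measurable_sum => B; case: (j \in _) => //.
apply: measurable_prod => i _; rewrite /softmax; case: (B i \in _) => //.
apply: measurable_funM => //.
(* The inverse of the nonnegative sum is rewritten as the power [-1], whose measurability is
   known. *)
apply: (eq_measurable_fun (fun v : profile R n m =>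
    (\sum_(C in powerset (available B i)) expR (b * utility (v i) p C)) `^ (-1))).
  by move=> v _; rewrite powR_inv1 // sumr_ge0 // => C _; exact: expR_ge0.
exact: (measurableT_comp (measurable_powR _)).
Qed.

Definition smooth_prob (R : realType) (n m : nat) (b : R)
    (D : probability (profile R n m) R) (p : 'rV[R]_m) (j : 'I_m) : \bar R :=
  \int[D]_(v in setT) (smooth_item b v p j)%:E.

Lemma smooth_prob_ge_half (R : realType) (n m : nat) (b : R)
    (D : probability (profile R n m) R) (p : 'rV[R]_m) (j : 'I_m) :
  (0 < n)%N -> 0 <= b -> p ord0 j = 0 -> ((2^-1 : R)%:E <= smooth_prob b D p j)%E.
Proof.
move=> n0 b0 pj.
have -> : (2^-1 : R)%:E = (\int[D]_(v in setT) (cst (2^-1 : R)%:E) v)%E.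
  rewrite integral_cst //.
  by rewrite [X in (_ * X)%E](@probability_setT _ _ _ D) mule1.
apply: ge0_le_integral => //.
- by move=> v _; rewrite lee_fin invr_ge0.
- by apply/measurable_EFinP; exact: measurable_smooth_item.
- by move=> v _; rewrite lee_fin; exact: smooth_item_ge_half.
Qed.

Lemma smooth_prob_stable (R : realType) (n m : nat) (b d : R)
    (D : probability (profile R n m) R) (p p' : 'rV[R]_m) (j : 'I_m) : 0 <= b ->
  (forall k, `|p ord0 k - p' ord0 k| <= d) ->
  (smooth_prob b D p' j <=
   (expR (2 * b * d * (n * m)%:R))%:E * smooth_prob b D p j)%E.
Proof.
move=> b0 pp'; rewrite /smooth_prob -ge0_integralZl //; first last.
- by move=> v _; rewrite lee_fin smooth_item_ge0.
- by apply/measurable_EFinP; exact: measurable_smooth_item.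
apply: ge0_le_integral => //.
- by move=> v _; rewrite lee_fin smooth_item_ge0.
- by apply/measurable_EFinP; exact: measurable_smooth_item.
- apply: measurable_funeM; apply/measurable_EFinP; exact: measurable_smooth_item.
- by move=> v _; rewrite -EFinM lee_fin; exact: smooth_item_stable.
Qed.

(** The events decrease to the empty set, so continuity from above applies. *)
Lemma tail_probability_le (d : measure_display) (T : measurableType d)
    (R : realType) (D : probability T R) (f : T -> R) (e : R) :
  measurable_fun setT f -> 0 < e ->
  exists k : nat, (D [set x | (k%:R < f x)%R]%classic <= e%:E)%E.
Proof.
move=> mf e0; pose F k := [set x | (k%:R < f x)%R]%classic.
have mF k : measurable (F k).
  rewrite (_ : F k = f @^-1` `]k%:R, +oo[%classic)%classic.
    by rewrite -[X in measurable X]setTI; exact: mf.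
  by apply/seteqP; split => x /=; rewrite in_itv /= andbT.
have F0 : (\bigcap_k F k)%classic = set0.
  apply/seteqP; split => // x Fx.
  have := Fx (Num.bound `|f x|) I; rewrite /F /=.
  by apply/negP; rewrite -leNgt (le_trans (ler_norm _)) // ltW // archi_boundP.
have := @nonincreasing_cvg_mu _ _ _ D F.
rewrite F0 measure0 => cvgF.
have {}cvgF : ((D \o F) x @[x --> \oo] --> 0%E)%classic.
  apply: cvgF => //; first by rewrite (le_lt_trans (probability_le1 _ _)) ?ltry.
  apply/nonincreasing_seqP => k; apply/subsetPset => x; rewrite /F /=.
  by apply: le_lt_trans; rewrite ler_nat.
have [k _ kP] := cvgF _ (open_ereal_lt' (e0 : 0%E < e%:E)%E).
by exists k; apply: ltW; exact: kP k (leqnn k).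
Qed.

(** Outside an event of probability at most 1/4 the total value is at most [k], and there the sale
    probability is at most 1/4. The bound [P] serves all [b] at once, which keeps prices bounded as
    [b] grows. *)
Lemma smooth_prob_le_half (R : realType) (n m : nat)
    (D : probability (profile R n m) R) :
  exists2 P : R, 0 < P & forall (b : R) (p : 'rV[R]_m) (j : 'I_m),
    1 <= b -> P <= p ord0 j -> (smooth_prob b D p j <= (2^-1 : R)%:E)%E.
Proof.
pose t (v : profile R n m) : R := \sum_(i < n) v i [set: 'I_m]%SET.
have mt : measurable_fun setT t.
  by apply: measurable_sum => i; exact: measurable_valuation.
have quarter_gt0 : 0 < 4^-1 :> R by rewrite invr_gt0.
have [k Dk] := tail_probability_le D mt quarter_gt0.
set F := [set x | _]%classic in Dk.
have mF : measurable F.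
  rewrite (_ : F = t @^-1` `]k%:R, +oo[%classic)%classic.
    by rewrite -[X in measurable X]setTI; exact: mt.
  by apply/seteqP; split => x /=; rewrite in_itv /= andbT.
(* Chosen so that [n.+1%:R * expR (- c)] is 1/4. *)
pose c : R := ln (4 * n.+1%:R).
have expc : expR (- c) = (4 * n.+1%:R)^-1.
  by rewrite expRN lnK // posrE mulr_gt0 // ltr0n.
have c0 : 0 <= c.
  by rewrite ln_ge0 // -natrM ler1n.
exists (k%:R + c + 1).
  by rewrite ltr_wpDl // addr_ge0.
move=> b p j b1 pj.
have b0 : 0 <= b by lra.
apply: (@le_trans _ _ (\int[D]_(v in setT) ((\1_F v)%:E + (4^-1 : R)%:E))%E).
  apply: ge0_le_integral => //.
  - by move=> v _; rewrite lee_fin smooth_item_ge0.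
  - by apply/measurable_EFinP; exact: measurable_smooth_item.
  - apply: emeasurable_funD => //; apply/measurable_EFinP.
    exact: measurable_indic.
  move=> v _; rewrite -EFinD lee_fin.
  have [vF|vF] := boolP (v \in F).
    rewrite indicE vF; apply: (le_trans (smooth_item_le1 _ _ _ _)).
    by rewrite lerDl invr_ge0.
  rewrite indicE (negbTE vF) add0r.
  have tk : t v <= k%:R.
    by rewrite leNgt; apply: contra vF => kt; exact: mem_set.
  apply: (@le_trans _ _ (n%:R * expR (- (b * c)))).
    apply: smooth_item_le => // i.
    have : v i [set: 'I_m]%SET <= t v.
      rewrite /t (bigD1 i) //= lerDl sumr_ge0 // => i' _.
      exact: valuation_ge0.
    lra.
  apply: (@le_trans _ _ (n.+1%:R * expR (- c))).
    rewrite ler_pM ?expR_ge0 // ?ler_nat // ler_expR lerN2.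
    by rewrite ler_peMl.
  by rewrite expc invfM mulrCA divff ?mulr1.
rewrite ge0_integralD //.
- rewrite integral_indic // setIT integral_cst //.
  rewrite [X in (_ + _ * X)%E](@probability_setT _ _ _ D) mule1.
  apply: (le_trans (leeD2r _ Dk)); rewrite -EFinD lee_fin; lra.
- by apply/measurable_EFinP; exact: measurable_indic.
Qed.

Lemma approximate_median (R : realType) (n m : nat)
    (D : probability (profile R n m) R) : (0 < n)%N -> (0 < m)%N ->
  exists P : R, forall b e : R, 1 <= b -> 0 < e ->
    exists p : 'rV[R]_m, (forall j, 0 <= p ord0 j <= P) /\
      forall j, ((expR (- e) / 2)%:E <= smooth_prob b D p j <=
                 (expR e / 2)%:E)%E.
Proof.
move=> n0; case: m D => // m D _.
have [P P0 Phalf] := smooth_prob_le_half D; exists P => b e b1 e0.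
have b0 : 0 <= b by lra.
(* [K / N] bounds the exponent in [smooth_prob_stable] for price vectors in one cell of the grid of
   mesh [P / N]; [N] is taken large enough to make it at most [e]. *)
pose K := 2 * b * P * (n * m.+1)%:R.
pose N := (Num.bound `|K / e|).+1.
have KN : 2 * b * (P / N%:R) * (n * m.+1)%:R <= e.
  rewrite (_ : _ * _ = K / N%:R); last by rewrite /K; ring.
  rewrite ler_pdivrMr ?ltr0n // mulrC -ler_pdivrMr //.
  apply: (le_trans (ler_norm _)); apply: ltW.
  by apply: (lt_trans (archi_boundP (normr_ge0 _))); rewrite ltr_nat.
pose pr (x : 'I_m.+1 -> nat) : 'rV[R]_m.+1 := \row_j ((x j)%:R * (P / N%:R)).
(* The two faces are decided by definition; the bounds they stand for hold at price [0] by
   [smooth_prob_ge_half] and at price [P] by [Phalf]. *)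
pose Q k x := (x k != 0%N) &&
  ((x k == N) || (smooth_prob b D (pr x) k <= (2^-1 : R)%:E)%E).
have [||q [qN qQ]] := @discrete_poincare_miranda m N Q (ltn0Sn _).
- by move=> k x xk; rewrite /Q xk.
- by move=> k x xk; rewrite /Q xk eqxx.
have stable x j : (forall k, (q k <= x k <= (q k).+1)%N) ->
    forall p p', (p = pr q /\ p' = pr x) \/ (p = pr x /\ p' = pr q) ->
  (smooth_prob b D p' j <= (expR e)%:E * smooth_prob b D p j)%E.
  move=> qx p p' pp'.
  have dist k : `|p ord0 k - p' ord0 k| <= P / N%:R.
    have /andP[qxk xqk] := qx k.
    have PN0 : 0 <= P / N%:R by rewrite divr_ge0 // ltW.
    have H : `|pr x ord0 k - pr q ord0 k| <= P / N%:R.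
      rewrite !mxE -mulrBl normrM (ger0_norm PN0) ler_piMl //.
      rewrite -natrB // ger0_norm ?ler0n // (ler_nat R _ 1); lia.
    by case: pp' => -[-> ->] //; rewrite distrC.
  apply: (le_trans (smooth_prob_stable D j b0 dist)).
  apply: lee_wpmul2r; last by rewrite lee_fin ler_expR.
  by apply: integral_ge0 => v _; rewrite lee_fin smooth_item_ge0.
exists (pr q); split => [j|j].
  rewrite mxE mulr_ge0 ?divr_ge0 ?(ltW P0) //= mulrCA ler_piMr ?(ltW P0) //.
  by rewrite ler_pdivrMr ?ltr0n // mul1r ler_nat ltnW.
(* Near [pr q] item [j] sells with probability at least 1/2 at [pr x] and at most 1/2 at [pr y];
   stability carries both bounds to [pr q]. *)
have [x [y [qx qy xQ yQ]]] := qQ j.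
have xhalf : ((2^-1 : R)%:E <= smooth_prob b D (pr x) j)%E.
  move: xQ; rewrite /Q negb_and negbK => /orP[/eqP xj|].
    by apply: smooth_prob_ge_half => //; rewrite mxE xj mul0r.
  by rewrite negb_or -ltNge => /andP[_ /ltW].
have yhalf : (smooth_prob b D (pr y) j <= (2^-1 : R)%:E)%E.
  case/andP: yQ => _ /orP[/eqP yj|//].
  by apply: Phalf => //; rewrite mxE yj mulrCA divff ?mulr1 // pnatr_eq0.
apply/andP; split.
  rewrite [leRHS](_ : _ = (expR (- e))%:E * ((expR e)%:E * smooth_prob b D (pr q) j))%E.
    rewrite EFinM lee_wpmul2l ?lee_fin ?expR_ge0 // (le_trans xhalf) //.
    by apply: (stable x j qx); left.
  by rewrite muleA -EFinM -expRD addNr expR0 mul1e.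
apply: (le_trans (stable y j qy (pr y) (pr q) _)); first by right.
by rewrite EFinM lee_wpmul2l // lee_fin expR_ge0.
Qed.

(** * The zero-temperature limit *)

Section SoftmaxLimit.
Local Open Scope classical_set_scope.

Lemma cvg_sumr (R : realType) (I : Type) (r : seq I) (P : pred I)
    (F : I -> nat -> R) (l : I -> R) :
  (forall i, P i -> F i n @[n --> \oo] --> l i) ->
  \sum_(i <- r | P i) F i n @[n --> \oo] --> \sum_(i <- r | P i) l i.
Proof. by apply: cvg_big => //; exact: add_continuous. Qed.

Lemma cvg_prodr (R : realType) (I : Type) (r : seq I) (P : pred I)
    (F : I -> nat -> R) (l : I -> R) :
  (forall i, P i -> F i n @[n --> \oo] --> l i) ->
  \prod_(i <- r | P i) F i n @[n --> \oo] --> \prod_(i <- r | P i) l i.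
Proof. by apply: cvg_big => //; exact: mul_continuous. Qed.

Lemma increasing_seq_cvgny (f : nat -> nat) :
  increasing_seq f -> f n @[n --> \oo] --> \oo.
Proof.
move=> /increasing_seqP fS; have nf n : (n <= f n)%N.
  by elim: n => // n IH; exact: leq_ltn_trans IH (fS n).
by apply/cvgnyPge => A; exists A => // n /= An; exact: leq_trans An (nf n).
Qed.

(** Bolzano-Weierstrass is applied to one coordinate after another; each refinement preserves the
    limits already obtained. *)
Lemma bounded_fin_subsequence (R : realType) (K : finType) (u : nat -> K -> R)
    (c : R) : (forall n k, `|u n k| <= c) ->
  exists2 f : nat -> nat, increasing_seq f &
    exists l : K -> R, forall k, u (f n) k @[n --> \oo] --> l k.
Proof.
move=> uc; suff [f fi fc] : exists2 f : nat -> nat, increasing_seq f &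
    forall k, k \in enum K -> cvgn (fun n => u (f n) k).
  exists f => //; exists (fun k => limn (fun n => u (f n) k)) => k.
  by apply: fc; rewrite mem_enum.
elim: (enum K) => [|k s [f fi fc]]; first by exists id.
have [|g gi gc] := @bolzano_weierstrass R (fun n => u (f n) k).
  exists c; split; first exact: num_real.
  by move=> x cx n _; exact: le_trans (uc _ _) (ltW cx).
exists (f \o g) => [x y|k']; first exact: etrans (fi _ _) (gi _ _).
rewrite inE => /orP[/eqP ->//|k's].
apply/cvg_ex; exists (limn (fun n => u (f n) k')).
exact: (cvg_comp _ (fun n => u (f n) k') (increasing_seq_cvgny gi) (fc _ k's)).
Qed.

(** Eventually [x n] is at most half its negative limit, so the exponent is at most
    [- (c * b n)]. *)
Lemma expR_scale_cvg0 (R : realType) (b x : nat -> R) (l : R) :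
  b n @[n --> \oo] --> +oo -> x n @[n --> \oo] --> l -> l < 0 ->
  expR (b n * x n) @[n --> \oo] --> (0 : R).
Proof.
move=> boo xl l0.
have [c c0 lc] : exists2 c, 0 < c & l < - c by exists (- (l / 2)); lra.
have cb : (c * b n) @[n --> \oo] --> +oo.
  apply/cvgryPge => A; apply: filterS (cvgry_ge boo (A / c)) => n.
  by rewrite ler_pdivrMr // mulrC.
have := cvg_comp _ (fun y => expR (- y)) cb (@cvgr_expR R).
apply: squeeze_cvgr (cvg_cst _).
near=> n; rewrite expR_ge0 /= ler_expR -mulNr mulrC.
have bn : 0 <= b n by near: n; exact: cvgry_ge.
have xn : x n <= - c by near: n; exact: cvgr_le xl _ lc.
by rewrite ler_wpM2r.
Unshelve. all: end_near. Qed.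

(** Undemanded bundles have a utility gap with negative limit and lose their mass. On the demand set
    utilities at [p] are constant, so those at [q n] are, up to a constant, the price differences
    that define [A]. *)
Lemma softmax_demand_cvg (R : realType) (m : nat) (b : nat -> R)
    (q : nat -> 'rV[R]_m) (p : 'rV[R]_m) (A : {set {set 'I_m}} -> {set 'I_m} -> R) :
  b n @[n --> \oo] --> +oo ->
  (forall j, q n ord0 j @[n --> \oo] --> p ord0 j) ->
  (forall E B, softmax (b n) (fun C : {set 'I_m} =>
      \sum_(j in C) (p ord0 j - q n ord0 j)) E B @[n --> \oo] --> A E B) ->
  forall (v : valuation R m) (M B : {set 'I_m}),
    softmax (b n) (utility v (q n)) (powerset M) B @[n --> \oo] -->
    A (demand v p M) B.
Proof.
move=> boo qp qA v M; set E := demand v p M.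
have uq C : utility v (q n) C @[n --> \oo] --> utility v p C.
  by apply: cvgB; [exact: cvg_cst | exact: cvg_sumr].
have /set0Pn[B0 B0E] := demand_neq0 v p M.
(* The demand set consists of the affordable ties: subsets of [M] with the same utility as one
   maximizer [B0]. *)
have EP C : (C \in E) = (C \in powerset M) && (utility v p C == utility v p B0).
  move: B0E; rewrite /E !inE => /andP[B0M /forallP B0max]; apply: andb_id2l => CM.
  apply/forallP/eqP => [Cmax|-> //].
  apply/eqP; rewrite eq_le (implyP (B0max C) CM) /=.
  exact: (implyP (Cmax B0) B0M).
have ES : E \subset powerset M by apply/fintype.subsetP => C; rewrite EP => /andP[].
have B0S : B0 \in powerset M by apply: (fintype.subsetP ES).
have out0 C : C \notin E ->
    softmax (b n) (utility v (q n)) (powerset M) C @[n --> \oo] --> (0 : R).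
  move=> CE; have [CM|CM] := boolP (C \in powerset M); last first.
    by rewrite /softmax (negbTE CM); exact: cvg_cst.
  have gap : utility v p C - utility v p B0 < 0.
    move: CE; rewrite EP CM /= => neq; rewrite subr_lt0 lt_neqAle neq /=.
    move: B0E CM; rewrite !inE => /andP[_ /forallP /(_ C) /implyP H] CM.
    exact: H.
  apply: (squeeze_cvgr _ (cvg_cst _) (expR_scale_cvg0 boo (cvgB (uq C) (uq B0)) gap)).
  by apply: nearW => n; rewrite softmax_ge0 softmax_le_gap.
have in1 : \sum_(C in E) softmax (b n) (utility v (q n)) (powerset M) C
    @[n --> \oo] --> (1 : R).
  have -> : (fun n => \sum_(C in E) softmax (b n) (utility v (q n)) (powerset M) C)
      = (fun n => 1 - \sum_(C | C \notin E)
          softmax (b n) (utility v (q n)) (powerset M) C).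
    apply/funext => n.
    rewrite -(softmax_sumT (b n) (utility v (q n)) (powerset_neq0 M)).
    by rewrite [X in _ = X - _](bigID (mem E)) /= addrK.
  rewrite -[X in _ --> X]subr0; apply: cvgB; first exact: cvg_cst.
  rewrite [X in _ --> X](_ : 0 = \sum_(C : {set 'I_m} | C \notin E) (0 : R)).
    by apply: cvg_sumr => C; exact: out0.
  by rewrite big1.
move=> B; have [BE|BE] := boolP (B \in E); last first.
  rewrite (_ : A E B = 0); first exact: out0.
  apply: (cvg_unique _ (qA E B)) => //.
  by rewrite /softmax (negbTE BE); exact: cvg_cst.
rewrite -[X in _ --> X]mulr1.
rewrite (_ : (fun n => _) = (fun n => softmax (b n) (fun C : {set 'I_m} =>
      \sum_(j in C) (p ord0 j - q n ord0 j)) E B) \*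
    (fun n => \sum_(C in E) softmax (b n) (utility v (q n)) (powerset M) C)).
  exact: cvgM.
apply/funext => n; rewrite /= (softmax_subset _ _ ES BE) /=; congr (_ * _).
apply: (@eq_softmaxD _ _ _ (utility v p B0)) => C.
by rewrite EP => /andP[_ /eqP <-]; rewrite /utility sumrB; ring.
Qed.

Lemma smooth_prob_cvg (R : realType) (n m : nat) (D : probability (profile R n m) R)
    (b : nat -> R) (q : nat -> 'rV[R]_m) (p : 'rV[R]_m) (A : choice_rule R m)
    (j : 'I_m) :
  b k @[k --> \oo] --> +oo ->
  (forall j, q k ord0 j @[k --> \oo] --> p ord0 j) ->
  (forall E B, softmax (b k) (fun C : {set 'I_m} =>
      \sum_(j in C) (p ord0 j - q k ord0 j)) E B @[k --> \oo] --> A E B) ->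
  smooth_prob (b k) D (q k) j @[k --> \oo] --> item_prob D p (fun=> A) j.
Proof.
move=> boo qp qA.
have cvg_item v : smooth_item (b k) v (q k) j @[k --> \oo] -->
    item_prob_given v p (fun=> A) j.
  apply: cvg_sumr => B _; apply: cvg_prodr => i _.
  exact: softmax_demand_cvg boo qp qA _ _ _.
have mk k : measurable_fun [set: profile R n m]
    (fun v : profile R n m => (smooth_item (b k) v (q k) j)%:E).
  by apply/measurable_EFinP; exact: measurable_smooth_item.
have cvgE (v : profile R n m) : (smooth_item (b k) v (q k) j)%:E @[k --> \oo] -->
    (item_prob_given v p (fun=> A) j)%:E.
  by apply: cvg_EFin; [exact: nearW | exact: cvg_item].
have [] // := @dominated_convergence _ (profile R n m) R D setT measurableT
  (fun k v => (smooth_item (b k) v (q k) j)%:E)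
  (fun v => (item_prob_given v p (fun=> A) j)%:E) (cst 1%E) mk.
(* The integrand of [item_prob] is measurable as a pointwise limit of measurable functions. *)
- by apply: emeasurable_fun_cvg mk _ => v _; exact: cvgE.
- by apply: aeW => v _; exact: cvgE.
- exact: (@finite_measure_integrable_cst _ _ _ D setT 1).
- apply: aeW => v k _.
  by rewrite gee0_abs lee_fin ?smooth_item_le1 ?smooth_item_ge0.
Qed.

Lemma approximate_median_limit (R : realType) (n m : nat)
    (D : probability (profile R n m) R) : (0 < n)%N -> (0 < m)%N ->
  exists (p : 'rV[R]_m) (A : choice_rule R m),
    (forall j, 0 <= p ord0 j) /\
    (forall j, item_prob D p (fun=> A) j = (2^-1 : R)%:E).
Proof.
move=> n0 m0; have [P HP] := approximate_median D n0 m0.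
(* Inverse temperature [k.+1] tends to infinity while the error exponent [1 / k.+1] tends to
   zero. *)
have /choice[q Hq] (k : nat) : exists p : 'rV[R]_m,
    (forall j, 0 <= p ord0 j <= P) /\
    forall j, ((expR (- harmonic k) / 2)%:E <= smooth_prob k.+1%:R D p j <=
               (expR (harmonic k) / 2)%:E)%E.
  by apply: HP; rewrite ?ler1n ?invr_gt0 ?ltr0n.
have [f fi [l fl]] : exists2 f : nat -> nat, increasing_seq f &
    exists l : 'I_m -> R, forall j, q (f k) ord0 j @[k --> \oo] --> l j.
  apply: (@bounded_fin_subsequence R _ (fun k j => q k ord0 j) P) => k j.
  by have [/(_ j)/andP[q0 qP] _] := Hq k; rewrite ger0_norm.
pose p : 'rV[R]_m := \row_j l j.
pose a k (E : {set {set 'I_m}}) B := softmax (f k).+1%:R (fun C : {set 'I_m} =>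
  \sum_(j in C) (p ord0 j - q (f k) ord0 j)) E B.
have a0 k E B : 0 <= a k E B by exact: softmax_ge0.
(* A second extraction, over the finitely many pairs of a collection and a bundle, makes the softmax
   of the price differences converge on all collections at once. *)
have [g gi [A0 gA]] : exists2 g : nat -> nat, increasing_seq g &
    exists A0 : {set {set 'I_m}} * {set 'I_m} -> R,
      forall EB, a (g k) EB.1 EB.2 @[k --> \oo] --> A0 EB.
  apply: (@bounded_fin_subsequence R _
    (fun k (EB : {set {set 'I_m}} * {set 'I_m}) => a k EB.1 EB.2) 1) => k EB.
  by rewrite ger0_norm // softmax_le1.
have {}gA E B : a (g k) E B @[k --> \oo] --> A0 (E, B) by exact: gA (E, B).
have A_ge0 (E : {set {set 'I_m}}) B : E != finset.set0 -> 0 <= A0 (E, B).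
  by move=> _; apply: (ler_cvg_to (cvg_cst 0) (gA E B)); exact: nearW.
have A_out (E : {set {set 'I_m}}) B :
    E != finset.set0 -> B \notin E -> A0 (E, B) = 0.
  move=> _ BE; apply: (cvg_unique _ (gA E B)) => //.
  by rewrite /a /softmax (negbTE BE); exact: cvg_cst.
have A_sum1 (E : {set {set 'I_m}}) :
    E != finset.set0 -> \sum_(B in E) A0 (E, B) = 1.
  move=> E0; have := cvg_sumr (fun B _ => gA E B) => /(_ (index_enum _) (mem E)).
  under eq_fun do rewrite softmax_sum1 //.
  by move=> h; apply: (cvg_unique _ h) => //; exact: cvg_cst.
pose A := ChoiceRule A_ge0 A_out A_sum1.
have fgoo := cvg_comp _ _ (increasing_seq_cvgny gi) (increasing_seq_cvgny fi).
have boo : ((f (g k)).+1%:R : R) @[k --> \oo] --> +oo.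
  apply: (cvg_comp _ (fun k => k.+1%:R : R) fgoo).
  by have := @cvgr_idn R; rewrite -cvg_shiftS.
exists p, A; split => [j|j].
  rewrite mxE; apply: (ler_cvg_to (cvg_cst 0) (fl j)); apply: nearW => k.
  by have [/(_ j)/andP[]] := Hq (f k).
have lim : smooth_prob (f (g k)).+1%:R D (q (f (g k))) j @[k --> \oo] -->
    item_prob D p (fun=> A) j.
  apply: smooth_prob_cvg => // j'; rewrite mxE.
  exact: (cvg_comp _ (fun k => q (f k) ord0 j') (increasing_seq_cvgny gi) (fl j')).
have harm_lim (s : R) : (expR (s * harmonic (f (g k))) / 2)%:E @[k --> \oo] -->
    (2^-1 : R)%:E.
  apply: cvg_EFin; first exact: nearW.
  rewrite -[X in _ --> X]mul1r -expR0 -(mulr0 s).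
  apply: cvgMr_tmp; apply: continuous_cvg; first exact: continuous_expR.
  apply: cvgMl_tmp; exact: (cvg_comp _ _ fgoo cvg_harmonic).
apply: (cvg_unique _ lim) => //.
apply: squeeze_cvge (harm_lim (- 1)) (harm_lim 1).
by apply: nearW => k; rewrite mulN1r mul1r; have [_] := Hq (f (g k)); apply.
Qed.

End SoftmaxLimit.

Theorem theorem4p13 (R : realType) (n m : nat) (hn : (0 < n)%N) (hm : (0 < m)%N)
    (D : probability (profile R n m) R) :
  exists (p : 'rV[R]_m) (A : 'I_n -> choice_rule R m),
    [/\ forall j : 'I_m, 0 <= p ord0 j,
        median_witness (2^-1 : R) D p A
      & forall j : 'I_m, item_prob D p A j = (2^-1 : R)%:E].
Proof.
have [p [A [p0 pA]]] := approximate_median_limit D hn hm.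
(* All agents share one choice rule. For [alpha] equal to 1/2 the interval in [median_witness] is a
   single point. *)
exists p, (fun=> A); split => // j.
by rewrite pA !lee_fin; apply/andP; split; lra.
Qed.
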